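(* Let $f$ be any welfare function that is anonymous, strictly monotone, and satisfies the Pigou-Dalton principle. Then there is no deterministic or randomized mechanism for allocating indivisible items among agents with (normalized) additive valuations that is Bayesian incentive compatible for the uniform prior and always outputs allocations that ex-post maximize $f$.
   Context: Setting: $m$ indivisible items $[m]$, $n$ agents $[n]$. Each agent $i$ has a private valuation vector $\mathbf v_i=(v_{i,1},\dots,v_{i,m})$ in the simplex $\Delta^{m-1}=\{(x_1,\dots,x_m):\sum_j x_j=1,\ x_j\ge 0\}$, and reports are also elements of $\Delta^{m-1}$. An allocation is $\mathbf x\in\{0,1\}^{n\times m}$ with $\sum_i x_{i,j}=1$ for every item $j$, and $u_i(\mathbf x)=\sum_j v_{i,j}x_{i,j}$. A mechanism is a rule defined for every number $n$ of agents and $m$ of items that maps each report profile to an allocation (deterministic) or to a probability distribution over allocations (randomized); the nonexistence statement is about mechanisms having the stated properties for all $n$ and $m$. Uniform prior: the $\mathbf v_i$ are independent and each is uniformly distributed on $\Delta^{m-1}$. BIC for the uniform prior: for every agent $i$, true valuation $\mathbf v_i$ and report $\mathbf b_i$, $\mathbb E_{\mathbf v_{-i}}[u_i(\mathbf x(\mathbf v_i,\mathbf v_{-i}))]\ge\mathbb E_{\mathbf v_{-i}}[u_i(\mathbf x(\mathbf b_i,\mathbf v_{-i}))]$, with $u_i$ computed with $\mathbf v_i$ and the expectation over the other agents' valuations drawn from the prior and over any randomness of the mechanism. A welfare function is $f:\mathbb R^n_{\ge0}\to\mathbb R$ (given for each $n$). An allocation $\mathbf x$ maximizes $f$ if $f(u_1(\mathbf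 x),\dots,u_n(\mathbf x))\ge f(u_1(\mathbf y),\dots,u_n(\mathbf y))$ for all allocations $\mathbf y$. ''Always outputs allocations that ex-post maximize $f$'' means: on every report profile, every allocation the mechanism outputs (with positive probability) maximizes $f$ with respect to the reported valuations. Anonymous: $f(x_1,\dots,x_n)=f(x_{\pi_1},\dots,x_{\pi_n})$ for every permutation $\pi$ of $[n]$. Strictly monotone: $f(x)>f(y)$ whenever $x_i\ge y_i$ for all $i$ and $x_j>y_j$ for some $j$. Pigou-Dalton principle: for any $x,y\in\mathbb R^n_{\ge 0}$ such that there are distinct $i,j\in[n]$ with (i) $x_i+x_j=y_i+y_j$, (ii) $x_i>x_j$, (iii) $x_i>y_i>x_j$, and (iv) $x_k=y_k$ for all $k\notin\{i,j\}$, we have $f(x)\le f(y)$. *)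

(* Defs.v *)
From HB Require Import structures.
From mathcomp Require Import all_boot all_order all_algebra perm.
From mathcomp Require Import all_classical all_reals all_analysis.
From mathcomp Require Import measurable_realfun.

Set Implicit Arguments.
Unset Strict Implicit.
Unset Printing Implicit Defensive.

Import Order.TTheory GRing.Theory Num.Theory.
Import numFieldNormedType.Exports.

Local Open Scope classical_set_scope.
Local Open Scope ring_scope.

Section tuple_product.
Local Open Scope ereal_scope.
Context d (T : measurableType d) (R : realType).
Variable mu : {sigma_finite_measure set T -> \bar R}.

Definition cons_pair n (p : T * n.-tuple T) : n.+1.-tuple T := [tuple of p.1 :: p.2].

Lemma measurable_cons_pair n : measurable_fun setT (@cons_pair n).
Proof.
apply: (@measurable_cons _ _ (T * n.-tuple T)%type T (fun p => p.1) n (fun p => p.2)).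
  exact: measurable_fst.
exact: measurable_snd.
Qed.

HB.instance Definition _ n := isMeasurableFun.Build _ _ _ _ (@cons_pair n)
  (@measurable_cons_pair n).

Definition cons_measure n (nu : {sigma_finite_measure set (n.-tuple T) -> \bar R}) :
  set (n.+1.-tuple T) -> \bar R := pushforward (mu \x nu) (@cons_pair n).

Section instances.
Variables (n : nat) (nu : {sigma_finite_measure set (n.-tuple T) -> \bar R}).

Let cons_measure0 : cons_measure nu set0 = 0.
Proof. exact: measure0. Qed.

Let cons_measure_ge0 A : 0 <= cons_measure nu A.
Proof. exact: measure_ge0. Qed.

Let cons_measure_sigma_additive : semi_sigma_additive (cons_measure nu).
Proof. exact: measure_semi_sigma_additive. Qed.

HB.instance Definition _ := isMeasure.Build _ _ _ (cons_measure nu)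
  cons_measure0 cons_measure_ge0 cons_measure_sigma_additive.

Lemma cons_measure_sigma_finite : sigma_finite setT (cons_measure nu).
Proof.
have /sigma_finiteP[F [TF ndF Foo]] := sigma_finiteT mu.
have /sigma_finiteP[G [TG ndG Goo]] := sigma_finiteT nu.
pose g (t : n.+1.-tuple T) := (thead t, [tuple of behead t]).
have mg : measurable_fun setT g.
  apply/measurable_fun_pair.
    exact: measurable_tnth.
  exact: measurable_behead.
have gK : cancel (@cons_pair n) g.
  by move=> [x t]; rewrite /g /cons_pair theadE; congr pair; exact: val_inj.
exists (fun k => g @^-1` (F k `*` G k)).
  rewrite -preimage_bigcup -[LHS](preimage_setT g); congr preimage.
  rewrite -setXTT TF TG predeqE => -[x y]; split.
    move=> [/= [i _ Fix] [j _ Gjy]]; exists (maxn i j) => //; split.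
    - by move: x Fix; exact/subsetPset/ndF/leq_maxl.
    - by move: y Gjy; exact/subsetPset/ndG/leq_maxr.
  by move=> [i _ []/= ? ?]; split; exists i.
move=> k; have [mF Fk] := Foo k; have [mG Gk] := Goo k.
have mFG : measurable (F k `*` G k) by exact: measurableX.
split; first by rewrite -[X in measurable X]setTI; exact: mg.
rewrite /cons_measure /pushforward -comp_preimage.
rewrite (_ : g \o _ = id); last by apply/funext => p /=; rewrite gK.
by rewrite preimage_id product_measure1E// lte_mul_pinfty// ge0_fin_numE.
Qed.

HB.instance Definition _ := Measure_isSigmaFinite.Build _ _ _ (cons_measure nu)
  cons_measure_sigma_finite.

End instances.

Fixpoint tuple_measure n : {sigma_finite_measure set (n.-tuple T) -> \bar R} :=
  match n with
  | 0 => dirac [tuple]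
  | n'.+1 => cons_measure (tuple_measure n')
  end.

End tuple_product.

Arguments tuple_measure {d T R} mu n.

Section uniform_simplex.
Variable R : realType.

Definition simplex m : set (m.-tuple R) :=
  [set x | (forall j, 0 <= tnth x j) /\ \sum_(j < m) tnth x j = 1].

Variable k : nat.

(* The image of the simplex of [R^(k+1)] under the map forgetting the last
   coordinate, and the inverse of that map. *)
Definition corner : set (k.-tuple (measurableTypeR R)) :=
  [set x | (forall j, 0 <= tnth x j) /\ \sum_(j < k) tnth x j <= 1].

Definition chart (x : k.-tuple (measurableTypeR R)) : k.+1.-tuple R :=
  [tuple of rcons x (1 - \sum_(j < k) tnth x j)].

Lemma measurable_tuple_sum :
  measurable_fun setT
    (fun x : k.-tuple (measurableTypeR R) => \sum_(j < k) tnth x j : R).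
Proof. by apply: measurable_sum => j; exact: measurable_tnth. Qed.

Lemma measurable_corner : measurable corner.
Proof.
rewrite (_ : corner =
    (\bigcap_(j in [set: 'I_k]) ((fun x => tnth x j) @^-1` `[0, +oo[)) `&`
    (fun x => \sum_(j < k) tnth x j) @^-1` `]-oo, 1]).
  apply: measurableI.
    apply: fin_bigcap_measurable => //= j _.
    by rewrite -[X in measurable X]setTI; exact: measurable_tnth.
  by rewrite -[X in measurable X]setTI; exact: measurable_tuple_sum.
apply/seteqP; split => x /= [x0 x1]; split.
- by move=> j _; rewrite /= in_itv /= x0.
- by rewrite in_itv.
- by move=> j; have := x0 j I; rewrite /= in_itv /= andbT.
- by move: x1; rewrite in_itv.
Qed.

Lemma measurable_chart : measurable_fun setT chart.
Proof.
apply/measurable_fun_tnthP => i.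
have [ik|ki] := ltnP i k.
  rewrite (_ : _ \o _ = (fun x => tnth x (Ordinal ik))).
    exact: measurable_tnth.
  apply/funext => x /=.
  by rewrite !(tnth_nth 0) /= nth_rcons size_tuple ik.
rewrite (_ : _ \o _ = (fun x => 1 - \sum_(j < k) tnth x j)).
  apply: measurable_realfun.measurable_funB; first exact: measurable_cst.
  exact: measurable_tuple_sum.
apply/funext => x /=.
have ik : (i == k :> nat) by rewrite eqn_leq ki -ltnS ltn_ord.
by rewrite (tnth_nth 0) /= nth_rcons size_tuple ltnNge ki /= ik.
Qed.

HB.instance Definition _ := isMeasurableFun.Build _ _ _ _ chart measurable_chart.

(* The chart is affine, so it carries normalized Lebesgue measure to normalized
   surface measure.  [corner] has volume 1/k!, hence the default probability
   expected by [mnormalize] is never used. *)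
Definition uniform_simplex : probability (k.+1.-tuple R) R :=
  distribution
    (mnormalize (mrestr (tuple_measure lebesgue_measure k) measurable_corner)
                (@dirac _ (k.-tuple (measurableTypeR R)) (nseq_tuple k 0) R))
    chart.

End uniform_simplex.

Arguments simplex R m : clear implicits.
Arguments uniform_simplex R k : clear implicits.

(* Row [i] of the matrix marks the items received by agent [i]. *)
Definition is_allocation n m (x : 'M[bool]_(n, m)) : bool :=
  [forall j, (\sum_i x i j == 1)%N].

Notation allocation n m := {x : 'M[bool]_(n, m) | is_allocation x}.

Section mechanisms.
Variable R : realType.

Definition utility n m (v : m.-tuple R) (x : allocation n m) (i : 'I_n) : R :=
  \sum_(j < m) tnth v j * (val x i j)%:R.

Definition utilities n m (v : n.-tuple (m.-tuple R)) (x : allocation n m) :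
  n.-tuple R := [tuple utility (tnth v i) x i | i < n].

Definition reports n m : set (n.-tuple (m.-tuple R)) :=
  [set v | forall i, simplex R m (tnth v i)].

Record lottery (A : finType) := Lottery {
  weight :> A -> R;
  weight_ge0 : forall a, 0 <= weight a;
  weight_sum1 : \sum_a weight a = 1 }.

Lemma dirac_lottery_ge0 (A : finType) (a b : A) : 0 <= (b == a)%:R :> R.
Proof. exact: ler0n. Qed.

Lemma dirac_lottery_sum1 (A : finType) (a : A) : \sum_b (b == a)%:R = 1 :> R.
Proof. by rewrite (bigD1 a) //= eqxx big1 ?addr0 // => b /negPf->. Qed.

Definition dirac_lottery (A : finType) (a : A) : lottery A :=
  Lottery (dirac_lottery_ge0 a) (dirac_lottery_sum1 a).

(* Mechanisms are families over all numbers [n.+1] of agents and [m.+1] of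
   items: without agents, or without items, there is no allocation problem
   (no allocation of a nonempty set of items, resp. an empty simplex).  They are
   total on tuples of real vectors, but only their values on [reports] matter. *)
Definition deterministic_mechanism := forall n m,
  n.+1.-tuple (m.+1.-tuple R) -> allocation n.+1 m.+1.

Definition randomized_mechanism := forall n m,
  n.+1.-tuple (m.+1.-tuple R) -> lottery (allocation n.+1 m.+1).

Definition randomize (M : deterministic_mechanism) : randomized_mechanism :=
  fun n m v => dirac_lottery (M n m v).

Definition expected_utility n m (v : m.-tuple R) (p : lottery (allocation n m))
  (i : 'I_n) : R := \sum_x p x * utility v x i.

(* [w] lists the reports of the agents other than [i], in increasing order. *)
Definition profile n m (i : 'I_n.+1) (b : m.-tuple R) (w : n.-tuple (m.-tuple R)) :
    n.+1.-tuple (m.-tuple R) :=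
  [tuple if unlift i j is Some k then tnth w k else b | j < n.+1].

(* Expected utility of agent [i] with valuation [v] and report [b], the valuations
   of the other agents being independent and uniform on the simplex.  The
   integrand is nonnegative; when it is measurable up to a null set the integral
   is its expectation, and otherwise it is its lower integral, so that no
   regularity of mechanisms has to be assumed. *)
Definition interim_utility (M : randomized_mechanism) n m (i : 'I_n.+1)
    (v b : m.+1.-tuple R) : \bar R :=
  (\int[tuple_measure (uniform_simplex R m) n]_(w in @reports n m.+1)
     (expected_utility v (M n m (profile i b w)) i)%:E)%E.

Definition BIC (M : randomized_mechanism) : Prop :=
  forall n m (i : 'I_n.+1) (v b : m.+1.-tuple R),
    simplex R m.+1 v -> simplex R m.+1 b ->
    (interim_utility M i v b <= interim_utility M i v v)%E.

(* Only the values on nonnegative vectors matter. *)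
Definition welfare_function := forall n, n.-tuple R -> R.

Definition nonneg n (x : n.-tuple R) : Prop := forall i, 0 <= tnth x i.

Definition anonymous (f : welfare_function) : Prop :=
  forall n (x : n.-tuple R) (s : 'S_n), nonneg x ->
    f n x = f n [tuple tnth x (s i) | i < n].

Definition strictly_monotone (f : welfare_function) : Prop :=
  forall n (x y : n.-tuple R), nonneg x -> nonneg y ->
    (forall i, tnth y i <= tnth x i) -> (exists j, tnth y j < tnth x j) ->
    f n y < f n x.

Definition pigou_dalton (f : welfare_function) : Prop :=
  forall n (x y : n.-tuple R) (i j : 'I_n), nonneg x -> nonneg y -> i != j ->
    tnth x i + tnth x j = tnth y i + tnth y j ->
    tnth x j < tnth x i ->
    tnth x j < tnth y i < tnth x i ->
    (forall k, k != i -> k != j -> tnth x k = tnth y k) ->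
    f n x <= f n y.

Definition maximizes (f : welfare_function) n m (v : n.-tuple (m.-tuple R))
    (x : allocation n m) : Prop :=
  forall y : allocation n m, f n (utilities v y) <= f n (utilities v x).

Definition always_maximizes (f : welfare_function) (M : randomized_mechanism) : Prop :=
  forall n m (v : n.+1.-tuple (m.+1.-tuple R)), reports v ->
    forall x, 0 < M n m v x -> maximizes f v x.

End mechanisms.

(* Main.v *)
(** Two agents and two items already suffice.  There, whenever the agents value
    item 0 differently, Pigou-Dalton and strict monotonicity leave a single
    maximizer of [f]: item 0 goes to the agent who values it more and item 1 to
    the other one.  Against a uniform opponent, an agent who values item 0 at [a]
    thus gets [a^2 + (1-a)^2] in expectation by being truthful, but gets [a] by
    claiming to value only item 0; at [a = 3/4] this is [5/8 < 3/4]. *)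

Require Import Defs.
From mathcomp Require Import all_boot all_order all_algebra perm.
From mathcomp Require Import all_classical all_reals all_analysis measurable_realfun.
From mathcomp Require Import lra.

Set Implicit Arguments.
Unset Strict Implicit.
Unset Printing Implicit Defensive.

Import Order.TTheory GRing.Theory Num.Theory.

Local Open Scope classical_set_scope.
Local Open Scope ring_scope.

(** * Integral comparison and the uniform law on the one-dimensional simplex *)

(* [ge0_le_integral] asks for measurability, which mechanisms need not have. *)
Lemma nonmeasurable_ge0_le_integral d (T : measurableType d) (R : realType)
    (mu : {measure set T -> \bar R}) (D E : set T) (f g : T -> \bar R) :
  (forall x, D x -> 0 <= f x)%E -> (forall x, E x -> 0 <= g x)%E ->
  (forall x, (f \_ D) x <= (g \_ E) x)%E ->
  (\int[mu]_(x in D) f x <= \int[mu]_(x in E) g x)%E.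
Proof.
move=> f0 g0 fg; rewrite !ge0_integralE//.
(* Both integrals are suprema over nonnegative simple functions below the integrand, and those below
   [f \_ D] are also below [g \_ E]. *)
apply: le_ereal_sup => _ [h hf <-]; exists h => //= x.
exact: le_trans (hf x) (fg x).
Qed.

(** A one-fold product is [mu] times the Dirac mass at the empty tuple, so the section at [x] has
    mass 1 or 0 according to whether [[tuple x]] lies in [S]. *)
Lemma tuple_measure1 d (T : measurableType d) (R : realType)
    (mu : {sigma_finite_measure set T -> \bar R}) (S : set (1.-tuple T)) :
  measurable S ->
  tuple_measure mu 1 S = mu ((fun x => [tuple x]) @^-1` S).
Proof.
move=> mS.
have mf : measurable_fun setT (fun x : T => [tuple x]).
  exact: (@measurable_cons _ _ T T id 0 (fun=> [tuple])).
have mS' : measurable ((fun x => [tuple x]) @^-1` S).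
  by rewrite -[X in measurable X]setTI; exact: mf.
rewrite /= /cons_measure /pushforward /product_measure1.
transitivity (\int[mu]_x (\1_((fun x => [tuple x]) @^-1` S) x)%:E)%E; last first.
  by rewrite integral_indic ?setIT.
apply: eq_integral => x _ /=; rewrite /dirac /indic /= mem_xsection.
by congr (_%:R%:E); congr nat_of_bool; apply/idP/idP; rewrite !inE.
Qed.

(** This is what [chart] becomes for [k = 1]; [x] is the value of item 0. *)
Definition segment (R : realType) (x : R) : 2.-tuple R := [tuple x; 1 - x].

Lemma chart_segment (R : realType) (x : R) : chart [tuple x] = segment x.
Proof. by apply: val_inj; rewrite /= big_ord1. Qed.

Lemma mnormalize_total1 d (T : measurableType d) (R : realType)
    (mu : {measure set T -> \bar R}) (P : probability T R) (U : set T) :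
  mu setT = 1%E -> mnormalize mu P U = mu U.
Proof. by move=> mu1; rewrite /mnormalize mu1 onee_eq0/= invr1 mule1. Qed.

(** For [k = 1] the corner is the unit interval, of length 1, so normalization changes nothing. *)
Lemma uniform_simplex1 (R : realType) (S : set (2.-tuple R)) : measurable S ->
  uniform_simplex R 1 S = lebesgue_measure (@segment R @^-1` S `&` `[0, 1]).
Proof.
move=> mS.
have mchartS : measurable (@chart R 1 @^-1` S).
  by rewrite -[X in measurable X]setTI; exact: measurable_chart.
have cornerE : (fun x : R => [tuple x]) @^-1` corner (R:=R) (k := 1) = `[0, 1]%classic.
  apply/seteqP; split => x /=; rewrite /corner/= big_ord1 in_itv /=.
    by case=> /(_ ord0) x0 x1; apply/andP.
  by case/andP => x0 x1; split => // i; rewrite ord1.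
have evidenceE : mrestr (tuple_measure lebesgue_measure 1)
    (measurable_corner (R := R) (k := 1)) setT = 1%E.
  rewrite /mrestr setTI tuple_measure1 ?cornerE; last exact: measurable_corner.
  apply: etrans (lebesgue_measure_itv `[0%R, 1%R]) _.
  by rewrite /= lte_fin ltr01 sube0.
apply: etrans (mnormalize_total1 _ _ evidenceE) _.
have mchart_corner : measurable (@chart R 1 @^-1` S `&` corner (k := 1)).
  by apply: measurableI => //; exact: measurable_corner.
apply: etrans (tuple_measure1 _ mchart_corner) _.
rewrite preimage_setI cornerE; congr (lebesgue_measure (_ `&` _)).
by apply/funext => x /=; rewrite /preimage/= chart_segment.
Qed.

Lemma measurable_simplex (R : realType) m : measurable (simplex R m).
Proof.
rewrite (_ : simplex R m =
    (\bigcap_(j in [set: 'I_m]) ((fun x => tnth x j) @^-1` `[0, +oo[)) `&`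
    (fun x => \sum_(j < m) tnth x j) @^-1` [set 1]).
  apply: measurableI.
    apply: fin_bigcap_measurable => //= j _.
    by rewrite -[X in measurable X]setTI; exact: measurable_tnth.
  by rewrite -[X in measurable X]setTI; exact: (@measurable_tuple_sum R m).
apply/seteqP; split => x /= [x0 x1]; split => //.
- by move=> j _; rewrite /= in_itv /= x0.
- by move=> j; have := x0 j I; rewrite /= in_itv /= andbT.
Qed.

Lemma measurable_reports (R : realType) n m : measurable (@reports R n m).
Proof.
rewrite (_ : @reports R n m =
    \bigcap_(i in [set: 'I_n]) ((fun w => tnth w i) @^-1` simplex R m)).
  apply: fin_bigcap_measurable => //= i _.
  rewrite -[X in measurable X]setTI; apply: measurable_tnth => //.
  exact: measurable_simplex.
by apply/seteqP; split => w /= wP i; [move=> _|]; exact: wP.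
Qed.

(** * Allocations of two items between two agents *)

Lemma diag_allocation_subproof (b : bool) :
  is_allocation (\matrix_(i < 2, j < 2) ((i == j) (+) b)).
Proof.
by apply/forallP => j; rewrite !big_ord_recl big_ord0 !mxE; case: b j => [] [[|[|]]].
Qed.

(** At [b = false] each agent gets the item of its own index; [b = true] swaps the items. *)
Definition diag_allocation b : allocation 2 2 := Sub _ (diag_allocation_subproof b).

Lemma allocation_opp (x : allocation 2 2) j : val x ord_max j = ~~ val x ord0 j.
Proof.
have /forallP/(_ j) := valP x; rewrite !big_ord_recl big_ord0.
by rewrite (_ : lift _ _ = ord_max); [do 2 case: (val x _ _)|exact: val_inj].
Qed.

Lemma utility2 (R : realType) (a : R) (x : allocation 2 2) i :
  utility (segment a) x i = a * (val x i ord0)%:R + (1 - a) * (val x i ord_max)%:R.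
Proof.
rewrite /utility !big_ord_recl big_ord0 addr0 (_ : lift _ _ = ord_max)//.
exact: val_inj.
Qed.

(** Row 0 determines the whole allocation, so only four utility pairs occur. *)
Lemma utilities2 (R : realType) (a c : R) (x : allocation 2 2) :
  utilities [tuple segment a; segment c] x =
  [tuple a * (val x ord0 ord0)%:R + (1 - a) * (val x ord0 ord_max)%:R;
         c * (~~ val x ord0 ord0)%:R + (1 - c) * (~~ val x ord0 ord_max)%:R].
Proof.
apply: eq_from_tnth => i; rewrite tnth_mktuple; case: i => [[|[|//]] i2].
  by rewrite utility2 (_ : Ordinal i2 = ord0)//; exact: val_inj.
by rewrite utility2 (_ : Ordinal i2 = ord_max) ?allocation_opp//; exact: val_inj.
Qed.

(** * Welfare comparison of the four utility pairs *)

Section welfare_of_pairs.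
Variables (R : realType) (f : welfare_function R).
Hypotheses (f_anonymous : anonymous f) (f_monotone : strictly_monotone f)
  (f_pigou_dalton : pigou_dalton f).

Lemma nonneg_pair (p q : R) : 0 <= p -> 0 <= q -> nonneg [tuple p; q].
Proof. by move=> p0 q0 [[|[|]]]. Qed.

Lemma welfare_swap (p q : R) : 0 <= p -> 0 <= q ->
  f [tuple p; q] = f [tuple q; p].
Proof.
move=> p0 q0; rewrite (f_anonymous (tperm ord0 ord_max) (nonneg_pair p0 q0)).
congr f; apply: eq_from_tnth => i; rewrite tnth_mktuple.
case: i => [[|[|//]] i2].
  by rewrite (_ : Ordinal i2 = ord0) ?tpermL//; exact: val_inj.
by rewrite (_ : Ordinal i2 = ord_max) ?tpermR//; exact: val_inj.
Qed.

(** Strictness is stated through the sum so that callers need not say which coordinate grows and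
    [lra] settles the side conditions. *)
Lemma welfare_lt (p q p' q' : R) : 0 <= p -> 0 <= q -> p <= p' -> q <= q' ->
  p + q < p' + q' -> f [tuple p; q] < f [tuple p'; q'].
Proof.
move=> p0 q0 pp' qq' lt_sum; apply: f_monotone.
- by apply: nonneg_pair; lra.
- exact: nonneg_pair.
- by case=> [[|[|]]].
have [ltp|lep] := ltP p p'; first by exists ord0.
by exists ord_max; rewrite !(tnth_nth 0)/=; lra.
Qed.

(** A Pigou-Dalton transfer leads from [(1, 0)] to [(a, 1 - a)] without loss of welfare; raising
    [1 - a] to [1 - c] then gains strictly. *)
Lemma welfare_split_lt (a c : R) : 0 <= c -> c < a -> a <= 1 ->
  f [tuple 1; 0] < f [tuple a; 1 - c].
Proof.
(* The transfer must be strictly positive, so [a = 1] is treated apart, by monotonicity alone. *)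
move=> c0 ca a1; have [->|a_neq1] := eqVneq a 1; first by apply: welfare_lt; lra.
have a_lt1 : a < 1 by rewrite lt_neqAle a_neq1.
apply: (@le_lt_trans _ _ (f [tuple a; 1 - a])); last by apply: welfare_lt; lra.
apply: (f_pigou_dalton (i := ord0) (j := ord_max)) => //.
- exact: nonneg_pair.
- by apply: nonneg_pair; lra.
- by rewrite !(tnth_nth 0)/=; lra.
- by rewrite !(tnth_nth 0)/=; apply/andP; split; lra.
- by move=> [[|[|]]].
Qed.

Lemma welfare_split_lt01 (a c : R) : 0 <= c -> c < a -> a <= 1 ->
  f [tuple 0; 1] < f [tuple a; 1 - c].
Proof. by move=> *; rewrite welfare_swap//; exact: welfare_split_lt. Qed.

(** By anonymity the left pair may be read as [(c, 1 - a)], which [(a, 1 - c)] dominates in both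
    coordinates. *)
Lemma welfare_exchange_lt (a c : R) : 0 <= c -> c < a -> a <= 1 ->
  f [tuple 1 - a; c] < f [tuple a; 1 - c].
Proof.
by move=> c0 ca a1; rewrite welfare_swap; [apply: welfare_lt| |]; lra.
Qed.

(** The pair [(a, 1 - c)], attained by [diag_allocation false], strictly beats the other three. *)
Lemma maximizer_gt (a c : R) (x : allocation 2 2) :
  0 <= c -> c < a -> a <= 1 -> maximizes f [tuple segment a; segment c] x ->
  val x ord0 ord0 /\ ~~ val x ord0 ord_max.
Proof.
move=> c0 ca a1 /(_ (diag_allocation false)); rewrite !utilities2 !mxE/=.
have := welfare_split_lt c0 ca a1.
have := welfare_exchange_lt c0 ca a1.
have := welfare_split_lt01 c0 ca a1.
case: (val x _ _) (val x _ _) => [] [] //=.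
all: rewrite !mulr1 !mulr0 ?addr0 ?add0r ?subrKC.
all: by move=> h1 h2 h3; rewrite leNgt (h1, h2, h3).
Qed.

Lemma maximizer_lt (a c : R) (x : allocation 2 2) :
  0 <= a -> a < c -> c <= 1 -> maximizes f [tuple segment a; segment c] x ->
  ~~ val x ord0 ord0 /\ val x ord0 ord_max.
Proof.
move=> a0 ac c1 /(_ (diag_allocation true)); rewrite !utilities2 !mxE/=.
(* Exchanging the two items turns [a < c] into [1 - c < 1 - a], so the previous inequalities
   apply. *)
have := @welfare_split_lt (1 - a) (1 - c).
have := @welfare_exchange_lt (1 - a) (1 - c).
have := @welfare_split_lt01 (1 - a) (1 - c).
rewrite !subKr.
case: (val x _ _) (val x _ _) => [] [] //=.
all: rewrite !mulr1 !mulr0 ?addr0 ?add0r ?subrKC.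
all: move=> h1 h2 h3; rewrite leNgt (h1, h2, h3)//; lra.
Qed.

End welfare_of_pairs.

(** * Expected utility under a lottery *)

Section lotteries.
Variables (R : realType) (n m : nat).
Variables (v : m.-tuple R) (p : lottery R (allocation n m)) (i : 'I_n).
Hypothesis v_simplex : simplex R m v.

(** Outcomes of weight zero do not contribute; ex-post maximality constrains only the others. *)
Lemma expected_utility_cst (c : R) :
  (forall x, 0 < p x -> utility v x i = c) -> expected_utility v p i = c.
Proof.
move=> uc; rewrite -[RHS]mul1r -(weight_sum1 p) mulr_suml.
apply: eq_bigr => x _; have := weight_ge0 p x.
by rewrite le_eqVlt => /predU1P[<-|/uc->//]; rewrite !mul0r.
Qed.

Lemma expected_utility_ge0 : 0 <= expected_utility v p i.
Proof.
apply: sumr_ge0 => x _; apply: mulr_ge0; first exact: weight_ge0.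
by apply: sumr_ge0 => j _; rewrite mulr_ge0// v_simplex.1.
Qed.

Lemma expected_utility_le1 : expected_utility v p i <= 1.
Proof.
rewrite -(weight_sum1 p); apply: ler_sum => x _.
rewrite ler_piMr ?weight_ge0// -v_simplex.2; apply: ler_sum => j _.
by rewrite ler_piMr ?v_simplex.1// lern1 leq_b1.
Qed.

End lotteries.

(** * The law of a single uniform opponent *)

Lemma segment_simplex (R : realType) (x : R) :
  0 <= x <= 1 -> simplex R 2 (segment x).
Proof.
move=> /andP[x0 x1]; split; last by rewrite !big_ord_recl big_ord0 addr0 /= subrKC.
by case=> [[|[|]]]//= ?; rewrite (tnth_nth 0)/= subr_ge0.
Qed.

Section one_opponent.
Variable R : realType.

(** On [reports], this number determines all of [w]. *)
Definition opponent (w : 1.-tuple (2.-tuple R)) : R := tnth (tnth w ord0) ord0.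

Lemma measurable_opponent : measurable_fun setT opponent.
Proof.
apply: (@measurableT_comp _ _ _ _ _ _ (fun v : 2.-tuple R => tnth v ord0)).
  exact: measurable_tnth.
exact: measurable_tnth.
Qed.

Lemma reports_opponent w : @reports R 1 2 w ->
  0 <= opponent w <= 1 /\ w = [tuple segment (opponent w)].
Proof.
move=> /(_ ord0)[w0]; rewrite !big_ord_recl big_ord0 addr0 => w1.
have w01 := w0 ord0; have w02 := w0 (lift ord0 ord0).
split; first by rewrite /opponent; lra.
apply: eq_from_tnth => i; rewrite ord1 tnth0.
apply: eq_from_tnth => -[[|[|//]] j2].
  by rewrite [RHS](tnth_nth 0) /= /opponent; congr (tnth _ _); exact: val_inj.
rewrite [RHS](tnth_nth 0) /= /opponent -w1 addrAC subrr add0r.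
by congr (tnth _ _); exact: val_inj.
Qed.

Lemma profile_opponent (b : 2.-tuple R) w : @reports R 1 2 w ->
  profile ord0 b w = [tuple b; segment (opponent w)].
Proof.
move=> /reports_opponent[_ {1}->]; apply: eq_from_tnth => i.
rewrite tnth_mktuple; case: unliftP => [j|] ->; last by rewrite tnth0.
by rewrite !ord1.
Qed.

Lemma opponent_uniform (S : set (1.-tuple (2.-tuple R))) : measurable S ->
  tuple_measure (uniform_simplex R 1) 1 S =
  lebesgue_measure ((fun x : R => [tuple segment x]) @^-1` S `&` `[0, 1]).
Proof.
move=> mS.
have mS' : measurable ((fun t : 2.-tuple R => [tuple t]) @^-1` S).
  rewrite -[X in measurable X]setTI.
  by apply: (@measurable_cons _ _ (2.-tuple R) _ id 0 (fun=> [tuple])).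
by apply: etrans (tuple_measure1 _ mS) _; exact: (uniform_simplex1 mS').
Qed.

Lemma measurable_reports_opponent (I : set R) : measurable I ->
  measurable (@reports R 1 2 `&` @opponent @^-1` I).
Proof.
move=> mI; apply: measurableI; first exact: measurable_reports.
by rewrite -[X in measurable X]setTI; exact: measurable_opponent.
Qed.

(** The opponent's value of item 0 is uniform on the unit interval; [j] names the clipped interval,
    whose length is then directly computable. *)
Lemma opponent_itv (i j : interval R) : [set` i] `&` `[0, 1] = [set` j] ->
  tuple_measure (uniform_simplex R 1) 1 (@reports R 1 2 `&` @opponent @^-1` [set` i]) =
  lebesgue_measure [set` j].
Proof.
move=> <-; rewrite opponent_uniform; last exact: measurable_reports_opponent.
congr (lebesgue_measure _); apply/seteqP; split => x /=.
  by case=> -[].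
rewrite in_itv => -[xi x01]; split => //; split => // k.
by rewrite ord1 tnth0; exact: segment_simplex.
Qed.

End one_opponent.

(** * Interim utilities of agent 0 *)

Section two_agents_two_items.
Variables (R : realType) (f : welfare_function R) (M : randomized_mechanism R).
Hypotheses (f_anonymous : anonymous f) (f_monotone : strictly_monotone f)
  (f_pigou_dalton : pigou_dalton f) (M_maximizes : always_maximizes f M).

(** Agent 0 truly values item 0 at [a] but reports [b]. *)
Let payoff (a b : R) (w : 1.-tuple (2.-tuple R)) :=
  expected_utility (segment a) (M (profile ord0 (segment b) w)) ord0.

Lemma reports_profile (b : R) w : 0 <= b <= 1 -> @reports R 1 2 w ->
  reports (profile ord0 (segment b) w).
Proof.
move=> b01 wD i; rewrite tnth_mktuple; case: unliftP => [j|] _; first exact: wD.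
exact: segment_simplex.
Qed.

(** The report [b] decides that agent 0 gets exactly item 0, which is worth the true value [a]. *)
Lemma payoff_gt (a b : R) w : 0 <= b <= 1 -> @reports R 1 2 w ->
  opponent w < b -> payoff a b w = a.
Proof.
move=> b01 wD wb; apply: expected_utility_cst => x.
move=> /(M_maximizes (reports_profile b01 wD)).
have [/andP[w0 w1] _] := reports_opponent wD.
rewrite profile_opponent// => /(maximizer_gt f_anonymous f_monotone f_pigou_dalton).
by case=> //; [lra|move=> x0 /negbTE x1; rewrite utility2 x0 x1 mulr1 mulr0 addr0].
Qed.

Lemma payoff_lt (a b : R) w : 0 <= b <= 1 -> @reports R 1 2 w ->
  b < opponent w -> payoff a b w = 1 - a.
Proof.
move=> b01 wD wb; apply: expected_utility_cst => x.
move=> /(M_maximizes (reports_profile b01 wD)).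
have [/andP[w0 w1] _] := reports_opponent wD.
rewrite profile_opponent// => /(maximizer_lt f_anonymous f_monotone f_pigou_dalton).
by case=> //; [lra|move=> /negbTE x0 x1; rewrite utility2 x0 x1 mulr1 mulr0 add0r].
Qed.

(** The report 1 wins item 0 against every opponent value below 1, hence almost surely; elsewhere
    nonnegativity suffices for a lower bound. *)
Lemma interim_utility_extreme_report (a : R) : 0 <= a <= 1 ->
  (a%:E <= interim_utility M (ord0 : 'I_2) (segment a) (segment 1))%E.
Proof.
move=> a01; set mu := tuple_measure (uniform_simplex R 1) 1.
pose E := @reports R 1 2 `&` @opponent R @^-1` `]-oo, 1[.
have mE : measurable E by exact: measurable_reports_opponent.
have muE : mu E = 1%E.
  rewrite /mu (@opponent_itv _ _ `[0, 1[).
    by apply: etrans (lebesgue_measure_itv `[0%R, 1%R[) _;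
      rewrite /= lte_fin ltr01 sube0.
  by apply/seteqP; split => x /=; rewrite !in_itv /=; lra.
have -> : (a%:E = \int[mu]_(w in E) cst a%:E w)%E.
  by rewrite integral_cst// [X in (_ * X)%E]muE mule1.
apply: nonmeasurable_ge0_le_integral => w.
- by rewrite lee_fin; lra.
- by move=> _; rewrite lee_fin; apply: expected_utility_ge0; exact: segment_simplex.
rewrite /patch; case: ifPn => [|_].
  rewrite inE => -[wD]; rewrite /= in_itv/= => w1.
  rewrite mem_set// lee_fin [leRHS]payoff_gt//; lra.
case: ifPn => // _; rewrite lee_fin; apply: expected_utility_ge0.
exact: segment_simplex.
Qed.

(** Up to ties, agent 0 gets item 0, worth [a], with probability [a], and otherwise item 1, worth
    [1 - a]. *)
Lemma interim_utility_truthful (a : R) : 0 <= a <= 1 ->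
  (interim_utility M (ord0 : 'I_2) (segment a) (segment a) <=
   (a ^+ 2 + (1 - a) ^+ 2)%:E)%E.
Proof.
move=> a01; set mu := tuple_measure (uniform_simplex R 1) 1.
pose X := @opponent R; pose D := @reports R 1 2.
have mu_lt : mu (D `&` X @^-1` `]-oo, a[) = a%:E.
  rewrite /mu /D /X (@opponent_itv _ _ `[0, a[).
    apply: etrans (lebesgue_measure_itv `[0%R, a[) _; rewrite /= lte_fin sube0.
    (* For [a = 0] the interval is empty, and its measure 0 is still [a]. *)
    by case: ltP => // a_le0; congr EFin; lra.
  by apply/seteqP; split => x /=; rewrite !in_itv /=; lra.
have mu_eq : mu (D `&` X @^-1` `[a, a]) = 0%E.
  rewrite /mu /D /X (@opponent_itv _ _ `[a, a]).
    by apply: etrans (lebesgue_measure_itv `[a, a]) _; rewrite /= ltxx.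
  by apply/seteqP; split => x /=; rewrite !in_itv /=; lra.
have mu_gt : mu (D `&` X @^-1` `]a, +oo[) = (1 - a)%:E.
  rewrite /mu /D /X (@opponent_itv _ _ `]a, 1]).
    apply: etrans (lebesgue_measure_itv `]a, 1%R]) _; rewrite /= lte_fin.
    by case: ltP => // a_ge1; congr EFin; lra.
  by apply/seteqP; split => x /=; rewrite !in_itv /= ?andbT; lra.
pose ind (i : interval R) (w : 1.-tuple (2.-tuple R)) : \bar R :=
  (\1_(D `&` X @^-1` [set` i]) w)%:E.
(* In case of a tie a maximizing allocation may even give both items to agent 0,
   but ties have probability zero. *)
pose g (w : 1.-tuple (2.-tuple R)) :=
  (a%:E * ind `]-oo, a[ w + (ind `[a, a] w + (1 - a)%:E * ind `]a, +oo[ w))%E.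
have mind i : measurable_fun setT (ind i).
  apply/measurable_EFinP; apply: measurable_indic.
  exact: measurable_reports_opponent.
have ind0 i w : (0 <= ind i w)%E by rewrite lee_fin.
have a0 : (0 <= a%:E)%E by rewrite lee_fin; lra.
have a1 : (0 <= (1 - a)%:E)%E by rewrite lee_fin; lra.
(* Unlike the payoff, [g] is known to be measurable, so its integral splits over the three
   events. *)
have -> : ((a ^+ 2 + (1 - a) ^+ 2)%:E = \int[mu]_w g w)%E.
  rewrite ge0_integralD//; last 4 first.
  - by move=> w _; exact: mule_ge0.
  - exact: measurable_funeM.
  - by move=> w _; apply: adde_ge0 => //; exact: mule_ge0.
  - by apply: emeasurable_funD => //; exact: measurable_funeM.
  rewrite ge0_integralD//; last 2 first.
  - by move=> w _; exact: mule_ge0.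
  - exact: measurable_funeM.
  rewrite !ge0_integralZl// !integral_indic//;
    try exact: measurable_reports_opponent.
  rewrite !setIT [X in (_ * X + _)%E]mu_lt [X in (_ + (X + _))%E]mu_eq.
  rewrite [X in (_ + (_ + _ * X))%E]mu_gt.
  by rewrite add0e -!EFinM -EFinD !expr2.
apply: nonmeasurable_ge0_le_integral => w.
- by move=> _; rewrite lee_fin; apply: expected_utility_ge0; exact: segment_simplex.
- by move=> _; rewrite !adde_ge0// mule_ge0.
rewrite [leRHS]/patch mem_set// /patch; case: ifPn => [|_]; last first.
  by rewrite !adde_ge0// mule_ge0.
rewrite inE => wD; rewrite /g /ind !indicE !in_setI !(mem_set wD) /=.
have XE (i : interval R) : (w \in X @^-1` [set` i]) = (X w \in i).
  by apply/idP/idP => [/set_mem//|h]; exact: mem_set.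
rewrite !XE !in_itv /=.
have := @payoff_lt a a w a01 wD; have := @payoff_gt a a w a01 wD.
rewrite /payoff/X.
case: (ltgtP (opponent w) a) => [_ /(_ isT)-> _|_ _ /(_ isT)->|_ _ _].
all: rewrite -!EFinM -!EFinD lee_fin /= ?mulr0 ?mulr1 ?addr0 ?add0r //.
by apply: expected_utility_le1; exact: segment_simplex.
Qed.

End two_agents_two_items.

(** * Impossibility for randomized and deterministic mechanisms *)

Lemma no_randomized_mechanism (R : realType) (f : welfare_function R) :
  anonymous f -> strictly_monotone f -> pigou_dalton f ->
  ~ (exists M : randomized_mechanism R, BIC M /\ always_maximizes f M).
Proof.
move=> f_anonymous f_monotone f_pigou_dalton [M [M_BIC M_maximizes]].
(* Any [a] strictly between 1/2 and 1 would do, since [a - a^2 - (1 - a)^2 = (2a - 1)(1 - a)]. *)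
have a01 : 0 <= (3 / 4 : R) <= 1 by lra.
have b01 : 0 <= (1 : R) <= 1 by lra.
have := interim_utility_extreme_report f_anonymous f_monotone f_pigou_dalton
  M_maximizes a01.
(* The arguments [1 1] stand for two agents and two items, as mechanisms are indexed by
   predecessors. *)
move=> /le_trans/(_ (M_BIC 1 1 ord0 _ _ (segment_simplex a01) (segment_simplex b01))).
move=> /le_trans/(_ (interim_utility_truthful f_anonymous f_monotone
  f_pigou_dalton M_maximizes a01)).
rewrite lee_fin; lra.
Qed.

Theorem theorem5 (R : realType) (f : welfare_function R)
    (f_anonymous : anonymous f) (f_monotone : strictly_monotone f)
    (f_pigou_dalton : pigou_dalton f) :
  ~ (exists M : deterministic_mechanism R,
        BIC (randomize M) /\ always_maximizes f (randomize M)) /\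
  ~ (exists M : randomized_mechanism R, BIC M /\ always_maximizes f M).
Proof.
have no_M := no_randomized_mechanism f_anonymous f_monotone f_pigou_dalton.
by split => // -[M HM]; apply: no_M; exists (randomize M).
Qed.
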